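(* Let $p$ be an odd prime, $q=p^3$, and let $\mathbb{F}_q=\{c_0,c_1,\ldots,c_{q-1}\}$ be the finite field with $q$ elements. Let $a,b\in\mathfrak{S}_q$ be the permutations of $\mathbb{F}_q$ given by $$a=(c_{0},c_{1},\ldots,c_{p^2-1})(c_{p^2},c_{p^2+1},\ldots,c_{2p^2-1})\cdots (c_{p^2(p-1)},c_{p^2(p-1)+1},\ldots,c_{p^3-1}),$$ $$b=b_{0}\,b_{1}^{1+p}\,b_2^{1+2p}\cdots b_{p-1}^{1+(p-1)p},$$ where for $k\in\{0,1,\ldots,p-1\}$, $b_k$ is the $p^2$-cycle $$b_{k}=(c_{k},c_{p^2+k},\ldots,c_{(p-1)p^2+k},\;c_{p+k},c_{p+p^2+k},\ldots,c_{p+(p-1)p^2+k},\;\ldots,\;c_{(p-1)p+k},c_{(p-1)p+p^2+k},\ldots,c_{(p-1)p+(p-1)p^2+k}).$$ Then $G=\langle a,b\rangle$ is a subgroup of $\mathfrak{S}_q$ of order $q$, and every non-identity element of $G$ has no fixed point in $\mathbb{F}_q$.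
   Context: $\mathfrak{S}_q$ is the symmetric group on the set $\mathbb{F}_q$; products of permutations are composed right to left, $(xy)(c)=x(y(c))$. The enumeration $c_0,\ldots,c_{q-1}$ of $\mathbb{F}_q$ is arbitrary but fixed. In the cycle $b_k$ the entries are the elements $c_{jp+ip^2+k}$, listed with $i=0,\ldots,p-1$ running first for $j=0$, then for $j=1$, and so on up to $j=p-1$. *)

(* Defs.v *)
From HB Require Import structures.
From mathcomp Require Import all_boot all_order all_algebra all_fingroup.

Set Implicit Arguments.
Unset Strict Implicit.
Unset Printing Implicit Defensive.

Import GroupScope.

(* The cycle (x_1, ..., x_n): it maps each x_i to x_(i+1), x_n to x_1, and     *)
(* fixes every other point. The undup only makes the definition total; it is  *)
(* the identity on a list without repetitions.                                *)
Definition cycle_perm (T : finType) (s : seq T) : {perm T} :=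
  perm (can_inj (prev_next (undup_uniq s))).

(* MathComp composes permutations from left to right, (x * y) t = y (x t).    *)
(* The order is immaterial here: the factors of perm_a and those of perm_b    *)
(* are pairwise disjoint, hence commute, and a subset of a group generates    *)
(* the same subset for a group law and for the opposite law.                  *)
Section Generators.

Variables (p : nat) (F : finFieldType) (c : (p ^ 3).-tuple F).

(* All the indices used below are smaller than p ^ 3, so that the default     *)
(* value of nth is never reached.                                             *)
Definition elt (n : nat) : F := nth 0%R c n.

Definition block_a (k : nat) : {perm F} :=
  cycle_perm [seq elt (k * p ^ 2 + i) | i <- iota 0 (p ^ 2)].

Definition perm_a : {perm F} := \prod_(k < p) block_a k.

(* The inner index i runs faster than the outer index j.                      *)
Definition block_b (k : nat) : {perm F} :=
  cycle_perm [seq elt (j * p + i * p ^ 2 + k) | j <- iota 0 p, i <- iota 0 p].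

Definition perm_b : {perm F} := \prod_(k < p) block_b k ^+ (1 + k * p).

End Generators.

(* Main.v *)
(** Write [n = x + y p + z p^2] in base [p] and [point x y z] for [c_n], extended
    to all natural numbers [x], [y], [z] by letting both [x] and [z] carry into
    [y] and reducing all digits modulo [p].  Then [a] maps [point x y z] to
    [point (x+1) y z] and [b] maps it to [point x (y+x) (z+1)].  Hence
    [a^p = b^p], [a^b = a^(1+p)] and [a^(p^2) = 1], so that [<a>] is normal in [G]
    with cyclic quotient of order at most [p] and [G] has order at most [p^3].
    Since [G] is transitive on the [p^3] points, it is regular. *)

Require Import Defs.
From mathcomp Require Import all_boot all_order all_algebra all_fingroup.
From mathcomp Require Import cyclic zify.

(** * Action of one cycle and of products of disjoint permutations *)

Lemma cycle_perm_notin (T : finType) (s : seq T) (x : T) :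
  x \notin s -> cycle_perm s x = x.
Proof.
by move=> xs; rewrite permE next_nth mem_undup (negPf xs).
Qed.

Lemma cycle_perm_nth (T : finType) (x0 : T) (s : seq T) (i : nat) :
  uniq s -> 0 < size s ->
  cycle_perm s (nth x0 s (i %% size s)) = nth x0 s (i.+1 %% size s).
Proof.
move=> us s0; have lti := ltn_pmod i s0.
rewrite permE undup_id // next_nth mem_nth // index_uniq //.
rewrite -addn1 -modnDml addn1.
case: s us s0 lti => //= y s _ _; move: (i %% _) => {}i.
(* At the last index [nth] runs off the tail and returns its default [y], the head of the cycle:
   this is the wrap-around. *)
rewrite ltnS leq_eqVlt => /predU1P[->|lti].
  by rewrite modnn nth_default.
by rewrite modn_small //=; apply: set_nth_default.
Qed.

Lemma cycle_permX_nth (T : finType) (x0 : T) (s : seq T) (m i : nat) :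
  uniq s -> 0 < size s ->
  (cycle_perm s ^+ m)%g (nth x0 s (i %% size s)) = nth x0 s ((i + m) %% size s).
Proof.
move=> us s0; elim: m i => [|m IHm] i; first by rewrite expg0 perm1 addn0.
by rewrite expgS permM cycle_perm_nth // IHm addSnnS.
Qed.

Lemma permX_fix (T : finType) (s : {perm T}) (m : nat) (x : T) :
  s x = x -> (s ^+ m)%g x = x.
Proof.
by move=> sx; elim: m => [|m IHm]; rewrite ?expg0 ?perm1 // expgS permM sx.
Qed.

Lemma prod_perm_fix (T : finType) (I : eqType) (r : seq I) (f : I -> {perm T})
    (x : T) :
  (forall j, j \in r -> f j x = x) -> (\prod_(j <- r) f j)%g x = x.
Proof.
elim: r => [|j r IHr] fx; first by rewrite big_nil perm1.
rewrite big_cons permM fx ?mem_head // IHr // => i ir.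
by rewrite fx // inE ir orbT.
Qed.

(** The factors before [f k] fix [x], and those after it fix the image of [x], so only [f k]
    acts. *)
Lemma prod_perm_at (T : finType) (n : nat) (f : nat -> {perm T}) (k : nat) (x : T) :
  k < n -> (forall j, j != k -> f j x = x) ->
  (forall j, j != k -> f j (f k x) = f k x) ->
  (\prod_(j < n) f j)%g x = f k x.
Proof.
move=> kn fx fy; rewrite -(big_mkord xpredT f).
have: uniq (index_iota 0 n) by apply: iota_uniq.
have: k \in index_iota 0 n by rewrite mem_index_iota.
case/splitPr=> r1 r2; rewrite uniq_catC /= mem_cat negb_or -andbA.
case/and3P=> kr2 kr1 _; rewrite big_cat big_cons !permM.
rewrite (@prod_perm_fix _ _ r1); last first.
  by move=> j jr; apply: fx; apply: contraNneq kr1 => <-.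
rewrite prod_perm_fix // => j jr.
by apply: fy; apply: contraNneq kr2 => <-.
Qed.

(** * Arithmetic of base [p] digits *)

Lemma allpairs_iota (T : Type) (f : nat -> nat -> T) (m p : nat) :
  0 < p ->
  [seq f j i | j <- iota 0 m, i <- iota 0 p] =
  [seq f (v %/ p) (v %% p) | v <- iota 0 (m * p)].
Proof.
move=> p0; elim: m => [|m IHm] //.
rewrite -addn1 iotaD allpairs_cat IHm mulnDl mul1n iotaD map_cat !add0n /=.
rewrite cats0; congr (_ ++ _); rewrite -[m * p]addn0 iotaDl -map_comp.
apply/eq_in_map => i; rewrite mem_iota /= add0n => ip.
by rewrite divnMDl // divn_small // addn0 modnMDl modn_small.
Qed.

(** The term [x %/ p] is the carry from the low digit into the high one. *)
Lemma modn_digits (p x y : nat) :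
  0 < p -> (x + y * p) %% p ^ 2 = x %% p + (y + x %/ p) %% p * p.
Proof.
move=> p0; rewrite {1}(divn_eq x p) addnAC -mulnDl (addnC _ y).
rewrite {1}(divn_eq (y + x %/ p) p) mulnDl -mulnA mulnn -addnA modnMDl.
rewrite modn_small; first by rewrite addnC.
rewrite -mulnn; apply: (@leq_trans (((y + x %/ p) %% p).+1 * p)).
  by rewrite mulSn addnC ltn_add2r ltn_pmod.
by rewrite leq_mul2r ltn_pmod ?orbT.
Qed.

(** * Indices of the entries of each cycle *)

Section Coordinates.

Variables (p : nat) (F : finFieldType) (c : (p ^ 3).-tuple F).
Hypotheses (p_gt0 : 0 < p) (c_uniq : uniq c).

Let elt_inj (m n : nat) : m < p ^ 3 -> n < p ^ 3 -> elt c m = elt c n -> m = n.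
Proof.
by move=> lm ln /eqP; rewrite /elt nth_uniq ?size_tuple // => /eqP.
Qed.

Let p2_gt0 : 0 < p ^ 2. Proof. by rewrite expn_gt0 p_gt0. Qed.

Let index_lt (u z : nat) : u < p ^ 2 -> z < p -> z * p ^ 2 + u < p ^ 3.
Proof.
move=> up zp; apply: (@leq_trans (z.+1 * p ^ 2)).
  by rewrite mulSn addnC ltn_add2r.
by rewrite (expnS p 2) leq_mul2r zp orbT.
Qed.

Definition block_a_seq (k : nat) : seq F :=
  [seq elt c (k * p ^ 2 + i) | i <- iota 0 (p ^ 2)].

(** Position [v = j * p + i] of the cycle [b_k] holds the element whose index has the digits [k],
    [j], [i], lowest first: the fast digit [i] of the position becomes the top digit of the
    index. *)
Definition block_b_index (k v : nat) : nat := v %/ p * p + v %% p * p ^ 2 + k.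

Definition block_b_seq (k : nat) : seq F :=
  [seq elt c (block_b_index k v) | v <- iota 0 (p ^ 2)].

Let block_bE (k : nat) : block_b c k = cycle_perm (block_b_seq k).
Proof.
rewrite /block_b (allpairs_iota _ (fun j i => elt c (j * p + i * p ^ 2 + k))) //.
Qed.

Let block_b_index_lt (k v : nat) :
  k < p -> v < p ^ 2 -> block_b_index k v < p ^ 3.
Proof.
move=> kp vp; rewrite /block_b_index addnAC addnC.
apply: index_lt; last exact: ltn_pmod.
have: v %/ p < p by rewrite ltn_divLR // mulnn.
rewrite -mulnn => jp; apply: (@leq_trans ((v %/ p).+1 * p)).
  by rewrite mulSn addnC ltn_add2r.
by rewrite leq_mul2r jp orbT.
Qed.

Let block_b_index_mod (k v : nat) : k < p -> block_b_index k v %% p = k.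
Proof.
by move=> kp; rewrite /block_b_index -mulnn mulnA -mulnDl modnMDl modn_small.
Qed.

Let block_b_index_inj (k v w : nat) : k < p ->
  v < p ^ 2 -> w < p ^ 2 -> block_b_index k v = block_b_index k w -> v = w.
Proof.
have divlt u : u < p ^ 2 -> u %/ p * p < p ^ 2.
  by move=> up; apply: leq_ltn_trans up; apply: leq_divM.
move=> kp vp wp /addIn E.
(* Reduction modulo [p ^ 2] removes the top digit and leaves the middle one, which is already below
   [p ^ 2]. *)
have Ed : v %/ p * p = w %/ p * p.
  have /(congr1 (modn ^~ (p ^ 2))) := E.
  by rewrite ![_ * p + _]addnC !modnMDl !modn_small ?divlt.
have Em : v %% p = w %% p.
  by move: E; rewrite Ed => /addnI/eqP; rewrite eqn_pmul2r // => /eqP.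
by rewrite (divn_eq v p) Ed Em -divn_eq.
Qed.

(** * Action of [a] and [b] as shifts of the position inside a cycle *)

Lemma perm_a_elt (u z : nat) : z < p ->
  perm_a c (elt c (z * p ^ 2 + u %% p ^ 2)) = elt c (z * p ^ 2 + u.+1 %% p ^ 2).
Proof.
move=> zp.
have block_at w : elt c (z * p ^ 2 + w %% p ^ 2)
    = nth 0%R (block_a_seq z) (w %% size (block_a_seq z)).
  rewrite size_map size_iota (nth_map 0) ?size_iota ?ltn_pmod //.
  by rewrite nth_iota ?ltn_pmod.
have uniq_z : uniq (block_a_seq z).
  rewrite map_inj_in_uniq ?iota_uniq // => i j; rewrite !mem_iota => ip jp.
  by move/elt_inj => /(_ (index_lt _ _ ip zp) (index_lt _ _ jp zp))/addnI.
have block_az : block_a c z (elt c (z * p ^ 2 + u %% p ^ 2))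
    = elt c (z * p ^ 2 + u.+1 %% p ^ 2).
  by rewrite !block_at cycle_perm_nth // size_map size_iota.
have block_aj j w : j < p -> j != z ->
    block_a c j (elt c (z * p ^ 2 + w %% p ^ 2)) = elt c (z * p ^ 2 + w %% p ^ 2).
  move=> jp /eqP jz; apply: cycle_perm_notin; apply/mapP => -[i].
  rewrite mem_iota => ip /elt_inj E; apply: jz.
  have /(congr1 (divn ^~ (p ^ 2))) :=
    E (index_lt _ _ (ltn_pmod _ p2_gt0) zp) (index_lt _ _ ip jp).
  by rewrite !divnMDl // !divn_small ?ltn_pmod // !addn0.
(* [prod_perm_at] asks for fixed points at every natural number [j], whereas the blocks are only
   known to be disjoint below [p]; hence the padding by the identity. *)
pose f j := if j < p then block_a c j else 1%g.
rewrite /perm_a (eq_bigr (fun j : 'I_p => f j)) => [|j _]; last first.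
  by rewrite /f ltn_ord.
rewrite (prod_perm_at _ _ f z) /f ?zp ?block_az // => j jz;
  by case: ifP => jp; rewrite ?perm1 ?block_aj.
Qed.

Lemma perm_b_elt (k v : nat) : k < p ->
  perm_b c (elt c (block_b_index k (v %% p ^ 2)))
  = elt c (block_b_index k ((v + (1 + k * p)) %% p ^ 2)).
Proof.
move=> kp.
have block_at w : elt c (block_b_index k (w %% p ^ 2))
    = nth 0%R (block_b_seq k) (w %% size (block_b_seq k)).
  rewrite size_map size_iota (nth_map 0) ?size_iota ?ltn_pmod //.
  by rewrite nth_iota ?ltn_pmod.
have uniq_k : uniq (block_b_seq k).
  rewrite map_inj_in_uniq ?iota_uniq // => i j; rewrite !mem_iota => ip jp.
  move/elt_inj => /(_ (block_b_index_lt _ _ kp ip) (block_b_index_lt _ _ kp jp)).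
  exact: block_b_index_inj.
have block_bk : (block_b c k ^+ (1 + k * p))%g (elt c (block_b_index k (v %% p ^ 2)))
    = elt c (block_b_index k ((v + (1 + k * p)) %% p ^ 2)).
  by rewrite block_bE !block_at cycle_permX_nth // size_map size_iota.
have block_bj j w : j < p -> j != k ->
    (block_b c j ^+ (1 + j * p))%g (elt c (block_b_index k (w %% p ^ 2)))
    = elt c (block_b_index k (w %% p ^ 2)).
  move=> jp /eqP jk; apply: permX_fix; rewrite block_bE.
  apply: cycle_perm_notin; apply/mapP => -[i].
  rewrite mem_iota => ip /elt_inj E; apply: jk.
  have /(congr1 (modn ^~ p)) :=
    E (block_b_index_lt _ _ kp (ltn_pmod _ p2_gt0)) (block_b_index_lt _ _ jp ip).
  by rewrite !block_b_index_mod.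
pose f j := if j < p then (block_b c j ^+ (1 + j * p))%g else 1%g.
rewrite /perm_b (eq_bigr (fun j : 'I_p => f j)) => [|j _]; last first.
  by rewrite /f ltn_ord.
rewrite (prod_perm_at _ _ f k) /f ?kp ?block_bk // => j jk;
  by case: ifP => jp; rewrite ?perm1 ?block_bj.
Qed.

(** * Action of [a] and [b] in three coordinates *)

Definition point (x y z : nat) : F :=
  elt c (x %% p + (y + x %/ p + z %/ p) %% p * p + z %% p * p ^ 2).

(** Inside a cycle of [a] the low digit of the position is [x], so reduction modulo [p ^ 2] carries
    [x] into [y] by itself and only the carry of [z] is written out. *)
Lemma point_a_block (x y z : nat) :
  point x y z = elt c (z %% p * p ^ 2 + (x + (y + z %/ p) * p) %% p ^ 2).
Proof. by rewrite modn_digits // addnAC [RHS]/elt addnC. Qed.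

(** Same reading with [x] and [z] exchanged: the low digit of a position in a cycle of [b] is
    [z]. *)
Lemma point_b_block (x y z : nat) :
  point x y z = elt c (block_b_index (x %% p) ((z + (y + x %/ p) * p) %% p ^ 2)).
Proof.
rewrite modn_digits // /block_b_index (addnC (z %% p)) divnMDl //.
rewrite (divn_small (ltn_pmod _ _)) //.
by rewrite addn0 modnMDl modn_mod addnC addnA.
Qed.

Lemma pointDx (x y z : nat) : point (x + p) y z = point x y.+1 z.
Proof. by rewrite /point modnDr divnDr // divnn p_gt0 addn1 addnS addSn. Qed.

Lemma pointDz (x y z : nat) : point x y (z + p) = point x y.+1 z.
Proof. by rewrite /point modnDr divnDr // divnn p_gt0 addn1 addnS !addSn. Qed.

Lemma pointMy (x y z m : nat) : point x (y + p * m) z = point x y z.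
Proof.
by rewrite /point -!addnA (addnC (p * m)) !addnA (mulnC p) (addnC _ (m * p)) modnMDl.
Qed.

Lemma perm_a_point (x y z : nat) : perm_a c (point x y z) = point x.+1 y z.
Proof. by rewrite !point_a_block perm_a_elt ?ltn_pmod. Qed.

Lemma perm_b_point (x y z : nat) : perm_b c (point x y z) = point x (y + x) z.+1.
Proof.
rewrite !point_b_block perm_b_elt ?ltn_pmod //; congr (elt c (block_b_index _ _)).
(* The exponent of the cycle involves [x %% p], not [x]; the difference shifts the position by a
   multiple of [p ^ 2], which is invisible. *)
have -> : z.+1 + (y + x + x %/ p) * p =
    x %/ p * p ^ 2 + (z + (y + x %/ p) * p + (1 + x %% p * p)).
  by rewrite {1}(divn_eq x p) -mulnn; lia.
by rewrite modnMDl.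
Qed.

Lemma perm_aX_point (m x y z : nat) :
  (perm_a c ^+ m)%g (point x y z) = point (x + m) y z.
Proof.
elim: m x => [|m IHm] x; first by rewrite perm1 addn0.
by rewrite expgS permM perm_a_point IHm addSnnS.
Qed.

Lemma perm_bX_point (m x y z : nat) :
  (perm_b c ^+ m)%g (point x y z) = point x (y + m * x) (z + m).
Proof.
elim: m y z => [|m IHm] y z; first by rewrite perm1 !addn0.
by rewrite expgS permM perm_b_point IHm addSnnS mulSn addnA.
Qed.

Lemma elt_point (n : nat) : n < p ^ 3 ->
  elt c n = point (n %% p ^ 2) 0 (n %/ p ^ 2).
Proof.
move=> np.
have zp : n %/ p ^ 2 < p by rewrite ltn_divLR // -expnS.
rewrite point_a_block (divn_small zp) mul0n addn0 modn_mod (modn_small zp).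
by rewrite -divn_eq.
Qed.

(** * Relations between [a] and [b] *)

Hypothesis c_all : forall x : F, x \in c.

Lemma eq_perm_point (s t : {perm F}) :
  (forall x y z, s (point x y z) = t (point x y z)) -> s = t.
Proof.
move=> st; apply/permP => e; have /(nthP 0%R)[n] := c_all e.
by rewrite size_tuple => np <-; rewrite -/(elt c n) elt_point.
Qed.

(** A shift of [x] or of [z] by [p] carries one unit into [y]; the further shift of [y] by [p * x]
    caused by [b] vanishes modulo [p]. *)
Lemma perm_aXp : (perm_a c ^+ p = perm_b c ^+ p)%g.
Proof.
apply: eq_perm_point => x y z.
by rewrite perm_aX_point perm_bX_point pointDx pointDz -addSn pointMy.
Qed.

Lemma perm_aXp2 : (perm_a c ^+ (p ^ 2) = 1)%g.
Proof.
apply: eq_perm_point => x y z; rewrite perm_aX_point perm1 !point_a_block.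
by rewrite addnAC modnDr.
Qed.

(** If [a] acts first, then [b] adds [x + 1] instead of [x] to [y]; this extra unit of [y] is the
    effect of [a ^+ p]. *)
Lemma perm_aJb : (perm_a c ^ perm_b c = perm_a c ^+ p.+1)%g.
Proof.
apply: (mulgI (perm_b c)); rewrite -conjgC; apply: eq_perm_point => x y z.
rewrite !permM perm_a_point !perm_b_point perm_aX_point.
by rewrite (addnS y) (addnS x p) -(addSn x p) pointDx.
Qed.

End Coordinates.

(** * Order and regularity of the group *)

Theorem theorem3p3 (p : nat) (p_prime : prime p) (p_odd : odd p)
    (F : finFieldType) (cardF : #|F| = (p ^ 3)%N)
    (c : (p ^ 3).-tuple F) (c_uniq : uniq c) (c_all : forall x : F, x \in c) :
  let G := <<[set perm_a c; perm_b c]>>%G in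
  #|G| = (p ^ 3)%N /\
  (forall g : {perm F}, g \in G -> g <> 1%g -> forall x : F, g x <> x).
Proof.
move=> G; have p_gt0 := prime_gt0 p_prime.
set a := perm_a c in G *; set b := perm_b c in G *.
have aG : a \in G by rewrite mem_gen // !inE eqxx.
have bG : b \in G by rewrite mem_gen // !inE eqxx orbT.
have GE : G = (<[a]> <*> <[b]>)%G.
  by apply: val_inj; rewrite /= joing_idl joing_idr.
have nab : <[b]>%g \subset 'N(<[a]>)%g.
  rewrite cycle_subG; apply/normP/eqP.
  (* One inclusion suffices, as conjugate subgroups have the same order. *)
  by rewrite eqEcard cardJg leqnn andbT -cycleJ cycle_subG perm_aJb // mem_cycle.
have leG : #|G| <= p ^ 3.
  have nag : (<[a]> <| G)%g.
    by rewrite GE /= norm_joinEr // /normal mulG_subl mulG_subG normG.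
  rewrite -(Lagrange (normal_sub nag)) expnSr leq_mul //.
    by rewrite dvdn_leq ?expn_gt0 ?p_gt0 // order_dvdn perm_aXp2.
  rewrite -card_quotient ?normal_norm //.
  (* The quotient by [<[a]>] is generated by the coset of [b], whose [p]-th power is that of
     [a ^+ p], hence trivial. *)
  rewrite GE /= norm_joinEr // quotientMidl quotient_cycle; last first.
    by rewrite -cycle_subG.
  rewrite dvdn_leq // order_dvdn -morphX -?cycle_subG //=.
  by rewrite -perm_aXp // coset_id ?mem_cycle.
have orbG : orbit 'P G (elt c 0) = [set: F].
  apply/setP => e; rewrite inE; have /(nthP 0%R)[n] := c_all e.
  rewrite size_tuple => np <-; rewrite -/(elt c n).
  (* Starting at [point 0 0 0], powers of [b] change only [z] because [x = 0]; then powers of [a]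
     set [x]. *)
  apply/orbitP; exists (b ^+ (n %/ p ^ 2) * a ^+ (n %% p ^ 2))%g.
    by rewrite groupM ?groupX.
  rewrite /= apermE permM elt_point ?expn_gt0 ?p_gt0 // div0n mod0n.
  by rewrite perm_bX_point // perm_aX_point // muln0 !add0n -elt_point.
have := card_orbit_stab 'P G (elt c 0).
rewrite orbG cardsT cardF => oG.
(* The orbit has [p ^ 3] elements, so [p ^ 3] divides the order of [G]. *)
have cardG : #|G| = p ^ 3.
  by apply/eqP; rewrite eqn_leq leG -oG leq_pmulr.
split=> // g gG g1 x gx; apply: g1.
have orbx : orbit 'P G x = [set: F].
  by rewrite -orbG; apply/orbit_eqP; rewrite orbG inE.
(* The orbit of [x] is now as large as [G], so the stabiliser of [x], which contains [g], is
   trivial. *)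
have := card_orbit_stab 'P G x; rewrite orbx cardsT cardF cardG => /eqP.
rewrite -[X in _ == X]muln1 eqn_pmul2l ?expn_gt0 ?p_gt0 // => /eqP/card1_trivg stab1.
by apply/set1P; rewrite -[[set 1%g]]stab1 !inE gG sub1set inE /= apermE gx.
Qed.
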